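(* Let $Q$ be a nonzero quadratic form on $\mathbb{F}_{q_1}/\mathbb{F}_q$ with rank $r_Q$, and let \[\mathcal{C}_Q'=\{(aQ(x)+\mathrm{Tr}_{q_2/q}(by)+c)_{(x,y)\in\mathbb{F}} : (a,b,c)\in\mathbb{F}_q\times\mathbb{F}_{q_2}\times\mathbb{F}_q\}.\] For each $r$ with $1\le r\le m_2+2$: (1) if $r_Q$ is even and $\epsilon=1$, then $d_r(\mathcal{C}_Q')=q^{M-r}(q^r-1-(q-1)q^{-r_Q/2})$ for $1\le r<m_2+2$ and $d_r(\mathcal{C}_Q')=q^M$ for $r=m_2+2$; (2) if $r_Q$ is even and $\epsilon=-1$, then $d_r(\mathcal{C}_Q')=q^{M-r}(q^r-1-q^{-r_Q/2})$ for $1\le r<m_2+2$ and $d_r(\mathcal{C}_Q')=q^M$ for $r=m_2+2$; (3) if $r_Q$ is odd, then $d_r(\mathcal{C}_Q')=q^{M-r}(q^r-1-q^{(1-r_Q)/2})$ for $1\le r<m_2+2$ and $d_r(\mathcal{C}_Q')=q^M$ for $r=m_2+2$.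
   Context: Let $p$ be an odd prime, $m\ge1$, $q=p^m$. Let $m_1,m_2$ be positive integers, $M=m_1+m_2$, $q_i=q^{m_i}$, $\mathbb{F}=\mathbb{F}_{q_1}\times\mathbb{F}_{q_2}$. $\mathrm{Tr}_{q^s/q}$ is the trace $\mathbb{F}_{q^s}\to\mathbb{F}_q$; $\eta$ is the quadratic character of $\mathbb{F}_q$ with $\eta(0)=0$. A quadratic form $Q$ on $\mathbb{F}_{q_1}/\mathbb{F}_q$ is a map $Q:\mathbb{F}_{q_1}\to\mathbb{F}_q$ with $Q(ax)=a^2Q(x)$ ($a\in\mathbb{F}_q$) such that $B_Q(x,y)=\frac12(Q(x+y)-Q(x)-Q(y))$ is $\mathbb{F}_q$-bilinear; its rank is $r_Q=m_1-\dim_{\mathbb{F}_q}\{x:B_Q(x,y)=0\ \forall y\}$. In suitable coordinates $Q=\sum_{i=1}^{r_Q}\lambda_ix_i^2$ with $\lambda_i\in\mathbb{F}_q^*$; $\varepsilon_Q=\eta(\lambda_1\cdots\lambda_{r_Q})$. Set $\epsilon=\varepsilon_Q(-1)^{(p-1)mr_Q/4}$ if $r_Q$ even, $\epsilon=\varepsilon_Q(-1)^{(p-1)m(r_Q+1)/4}$ if $r_Q$ odd. For a linear code $\mathcal{C}\subseteq\mathbb{F}_q^n$ of dimension $k$ and $1\le r\le k$, $d_r(\mathcal{C})=\min\#\mathrm{Supp}(K)$ over $r$-dimensional subspaces $K\subseteq\mathcal{C}$, where $\mathrm{Supp}(K)$ is the set of coordinates $i$ with $c_i\ne0$ for some $c\in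 K$. *)

(* Defs.v *)
From HB Require Import structures.
From mathcomp Require Import all_boot all_order all_algebra all_field.
Set Implicit Arguments. Unset Strict Implicit. Unset Printing Implicit Defensive.
Import Order.TTheory GRing.Theory Num.Theory.
Local Open Scope ring_scope.

Section Defs.
Variable F : finFieldType.

Definition eta (a : F) : int :=
  if a == 0 then 0 else if [exists b : F, b ^+ 2 == a] then 1 else -1.

(* trace Tr_{q^s/q}(y) = sum_{i<s} y^(q^i), read back in F (it lies in F*1) *)
Definition trace (L : fieldExtType F) (q s : nat) (y : L) : F :=
  coord [tuple (1 : L)] ord0 (\sum_(i < s) y ^+ (q ^ i)).

Section QF.
Variable L : fieldExtType F.
Implicit Type Q : L -> F.

Definition qf_B Q (x y : L) : F := (Q (x + y) - Q x - Q y) / 2%:R.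

Definition is_qform Q : Prop :=
  (forall (a : F) (x : L), Q (a *: x) = a ^+ 2 * Q x) /\
  (forall (a : F) (x x' y : L), qf_B Q (a *: x + x') y = a * qf_B Q x y + qf_B Q x' y) /\
  (forall (a : F) (x y y' : L), qf_B Q x (a *: y + y') = a * qf_B Q x y + qf_B Q x y').

Definition qf_rank Q (r : nat) : Prop :=
  exists U : {vspace L},
    (forall x, x \in U <-> (forall y, qf_B Q x y = 0)) /\
    r = (\dim {:L} - \dim U)%N.

Definition qf_diag Q (n r : nat) (e : n.-tuple L) (lam : 'I_n -> F) : Prop :=
  basis_of fullv e /\
  (forall i : 'I_n, (i < r)%N = (lam i != 0)) /\
  (forall x : 'I_n -> F, Q (\sum_(i < n) x i *: tnth e i) = \sum_(i < n) lam i * x i ^+ 2).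

Definition qf_eps n r (lam : 'I_n -> F) : int := eta (\prod_(i < n | (i < r)%N) lam i).
End QF.

Section Codes.
Variable T : finType.
Local Notation W := {ffun T -> F^o}.

Definition supp_card (K : {vspace W}) (s : nat) : Prop :=
  exists A : {set T}, (forall i, i \in A <-> exists2 w, w \in K & w i != 0) /\ #|A| = s.

Definition gen_weight (C : W -> Prop) (r d : nat) : Prop :=
  (exists K : {vspace W}, [/\ \dim K = r, (forall w, w \in K -> C w) & supp_card K d]) /\
  (forall (K : {vspace W}) s, \dim K = r -> (forall w, w \in K -> C w) -> supp_card K s ->
     (d <= s)%N).
End Codes.
End Defs.

Definition codeCQ (F : finFieldType) (L1 L2 : fieldExtType F) (q m2 : nat) (Q : L1 -> F)
  (w : {ffun (finvect_type L1 * finvect_type L2)%type -> F^o}) : Prop :=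
  exists (a : F) (b : L2) (c : F),
    w = [ffun xy : (finvect_type L1 * finvect_type L2)%type =>
          (a * Q xy.1 + trace q m2 (b * (xy.2 : L2)) + c : F^o)].

(* Main.v *)
Require Import Defs.
From HB Require Import structures.
From mathcomp Require Import all_boot all_order all_algebra all_field.
From mathcomp Require Import cyclic mxabelem ring lra zify.
Import Order.TTheory GRing.Theory Num.Theory.
Local Open Scope ring_scope.

(* Send (x, y) to the point (Q x, tau y) of F^(1 + m2), where tau y lists the
   traces of b_i y for a basis (b_i); tau is bijective because the trace form is
   nondegenerate, and the code consists of the affine functions of this point.
   An r-dimensional subcode with a common zero imposes r independent affine
   equations on the point, so it has at most q^(m2 + 1 - r) max_t N(t) common
   zeros, where N(t) is the number of x with Q x = t.  Equality holds for the
   span of Q - t, tau_1, ..., tau_(r-1) when N(t) is maximal.  Finally N(t) is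
   computed from the diagonal form of Q by adding one square at a time, using
   the value of sum_x eta(a x^2 + b). *)

(* [HB.structures] also exports an [eta]. *)
Local Notation eta := Defs.eta.

(** * The quadratic character of a finite field of odd order *)

Section Eta.
Variable F : finFieldType.
Hypothesis F2 : (2%:R : F) != 0.
Implicit Types a b c t x : F.

Lemma eta0 : eta (0 : F) = 0.
Proof. by rewrite /eta eqxx. Qed.

Lemma eta_sqr x : x != 0 -> eta (x ^+ 2) = 1.
Proof.
move=> x0; rewrite /eta sqrf_eq0 (negbTE x0).
by case: existsP => // -[]; exists x.
Qed.

Lemma eta_nsq t : t != 0 -> eta t != 1 -> eta t = -1.
Proof. by rewrite /eta => /negbTE ->; case: existsP. Qed.

Lemma sqr_of_eta t : eta t = 1 -> exists2 x, x != 0 & x ^+ 2 = t.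
Proof.
rewrite /eta; case: eqVneq => // t0; case: existsP => // -[x /eqP xt] _.
by exists x => //; apply: contra_neq t0 => x0; rewrite -xt x0 expr0n.
Qed.

Lemma eta_cases t : [\/ t = 0, eta t = 1 | eta t = -1].
Proof.
case: (eqVneq t 0) => [->|t0]; first by constructor 1.
by case: (eqVneq (eta t) 1) => h; [constructor 2|constructor 3; apply: eta_nsq].
Qed.

Lemma eqr_opp_char2 x : x != 0 -> x != - x.
Proof. by move=> x0; rewrite -subr_eq0 opprK -mulr2n -mulr_natl mulf_neq0. Qed.

Lemma card_sqrt t : #|[set x : F | x ^+ 2 == t]|%:R = 1 + eta t.
Proof.
case: (eta_cases t) => [->|h|h].
- rewrite eta0 (_ : [set _ | _] = [set 0]) ?cards1 //.
  by apply/setP => x; rewrite !inE sqrf_eq0.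
- have [y y0 yt] := sqr_of_eta _ h.
  rewrite h (_ : [set _ | _] = [set y; - y]) ?cards2 ?eqr_opp_char2 //.
  by apply/setP => x; rewrite !inE -yt eqf_sqr.
- rewrite h (_ : [set _ | _] = set0) ?cards0 //.
  apply/setP => x; rewrite !inE; apply/negP => /eqP xt.
  have x0 : x != 0.
    by apply/eqP => x0; move: h; rewrite -xt x0 expr0n eta0.
  by move: h; rewrite -xt eta_sqr.
Qed.

(** Each x is a square root of exactly one t, so the numbers [1 + eta t] of square roots add up to
    the order of F. *)
Lemma sum_eta : \sum_(t : F) eta t = 0.
Proof.
have : \sum_(t : F) #|[set x : F | x ^+ 2 == t]|%:R = #|F|%:R :> int.
  rewrite -natr_sum -(sum1_card F) [in RHS](partition_big (fun x : F => x ^+ 2) xpredT) //=.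
  congr _%:R; apply: eq_bigr => t _.
  by rewrite -sum1_card; apply: eq_bigl => x; rewrite !inE.
under eq_bigr do rewrite card_sqrt.
by rewrite big_split /= sumr_const -[X in _ = X]addr0 => /addrI.
Qed.

Lemma etaMsq x t : x != 0 -> eta (x ^+ 2 * t) = eta t.
Proof.
move=> x0; rewrite /eta mulf_eq0 sqrf_eq0 (negbTE x0) /=.
case: eqVneq => // t0; congr (if _ then _ else _).
apply/existsP/existsP => -[y /eqP yt]; last by exists (x * y); rewrite exprMn yt.
by exists (y / x); rewrite exprMn yt exprVn mulrAC divff ?mul1r ?sqrf_eq0.
Qed.

Lemma etaM : {morph @Defs.eta F : a b / a * b}.
Proof.
move=> a b; case: (eta_cases a) => [->|/sqr_of_eta [x x0 <-]|ha].
- by rewrite mul0r eta0 mul0r.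
- by rewrite etaMsq // eta_sqr // mul1r.
have a0 : a != 0 by apply/eqP => a0; move: ha; rewrite a0 eta0.
(* Every eta t + eta (a t) is nonpositive, and they sum to 0. *)
suff h t : eta t + eta (a * t) = 0.
  by rewrite ha mulN1r; apply/eqP; rewrite -addr_eq0 addrC h.
have le0 s : 0 <= - (eta s + eta (a * s)).
  case: (eta_cases s) => [->|/sqr_of_eta [x x0 <-]|->].
  - by rewrite mulr0 eta0.
  - by rewrite mulrC etaMsq // eta_sqr // ha.
  - by case: (eta_cases (a * s)) => [->|->|->] //; rewrite eta0.
have : \sum_t - (eta t + eta (a * t)) = 0.
  have aI : injective ( *%R a) by exact: mulfI.
  have := sum_eta; rewrite (reindex_inj aI) /= => sa.
  by rewrite sumrN big_split /= sum_eta sa addr0 oppr0.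
move=> /eqP; rewrite psumr_eq0 // => /allP /(_ t).
by rewrite mem_index_enum oppr_eq0 => /(_ isT) /eqP.
Qed.

Lemma eta1 : eta (1 : F) = 1.
Proof. by have := eta_sqr 1 (oner_neq0 F); rewrite expr1n. Qed.

Lemma etaX a n : eta (a ^+ n) = eta a ^+ n.
Proof.
elim: n => [|n IH]; first by rewrite !expr0 eta1.
by rewrite !exprS etaM IH.
Qed.

Lemma sum_eta_shift b :
  \sum_(x : F) eta (x ^+ 2 + b) = (if b == 0 then #|F|%:R else 0) - 1.
Proof.
case: eqVneq => [->|b0].
  under eq_bigr do rewrite addr0.
  rewrite (bigD1 0) //= expr0n eta0 add0r.
  under eq_bigr => x x0 do rewrite eta_sqr //.
  rewrite sumr_const -(@natrB _ _ 1) ?subn1; last by apply/card_gt0P; exists 0.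
  by rewrite -(cardC1 0).
(* y^2 = x^2 + b is the hyperbola u v = b in the coordinates u = y - x, v = x + y. *)
have E : \sum_(x : F) (1 + eta (x ^+ 2 + b)) = #|[set z : F * F | z.1 * z.2 == b]|%:R.
  under eq_bigr do rewrite -card_sqrt.
  rewrite -natr_sum -sum1_card; congr _%:R.
  transitivity (\sum_(z : F * F | (z.2 ^+ 2 == z.1 ^+ 2 + b)%R) 1)%N.
    under eq_bigr => x _ do rewrite -sum1_card.
    by rewrite pair_big_dep /=; apply: eq_bigl => z; rewrite !inE.
  rewrite (reindex_onto (fun z : F * F => ((z.2 - z.1) / 2%:R, (z.1 + z.2) / 2%:R))
                (fun z => (z.2 - z.1, z.1 + z.2))) /=.
    apply: eq_bigl => -[u v]; rewrite !inE /=.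
    rewrite -[X in _ && X]/((_ == u) && (_ == v)).
    have -> : (u + v) / 2%:R - (v - u) / 2%:R = u by field.
    have -> : (v - u) / 2%:R + (u + v) / 2%:R = v by field.
    rewrite !eqxx !andbT [X in _ == X]addrC -subr_eq.
    by have -> : ((u + v) / 2%:R) ^+ 2 - ((v - u) / 2%:R) ^+ 2 = u * v by field.
  by move=> [x y] _ /=; congr pair; field.
have cb : #|[set z : F * F | z.1 * z.2 == b]| = #|F|.-1.
  rewrite -(cardC1 (0 : F)) -(card_in_imset (f := fun u => (u, b / u)) (D := mem (predC1 0))).
    apply: eq_card => -[u v]; rewrite !inE /=; apply/eqP/imsetP => [uv|[w]].
      have u0 : u != 0 by apply: contra_neq b0 => u0; rewrite -uv u0 mul0r.
      by exists u => //; rewrite -uv mulrAC divff ?mul1r.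
    by move=> w0 [-> ->]; rewrite mulrC divfK //; exact: w0.
  by move=> u v _ _ [].
move: E; rewrite cb big_split /= sumr_const -subn1 natrB; last by apply/card_gt0P; exists 0.
by rewrite add0r => /addrI.
Qed.

Lemma sum_eta_affine_sq a b : a != 0 ->
  \sum_(x : F) eta (a * x ^+ 2 + b) = eta a * ((if b == 0 then #|F|%:R else 0) - 1).
Proof.
move=> a0; have -> : (b == 0) = (b / a == 0) by rewrite mulf_eq0 invr_eq0 (negbTE a0) orbF.
rewrite -sum_eta_shift mulr_sumr; apply: eq_bigr => x _.
by rewrite -etaM mulrDr [a * (b / a)]mulrC divfK.
Qed.

(** A generator g of the unit group satisfies g^((q-1)/2) = -1. It is not a square, since g = x^2
    would make this power x^(q-1) = 1. Hence [eta g] is -1 and multiplicativity concludes. *)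
Lemma etaN1 : eta (-1 : F) = (-1) ^+ (#|F|.-1)./2.
Proof.
pose rs := [seq x <- enum F | x != 0].
have crs : size rs = #|F|.-1.
  by rewrite -(cardC1 (0 : F)) cardE; congr size; rewrite /rs enumT.
have F0 : (0 < #|F|.-1)%N by rewrite -(cardC1 (0 : F)); apply/card_gt0P; exists 1; rewrite !inE oner_eq0.
have [|||g _ gP] := hasP (has_prim_root (rs := rs) F0 _ _ _).
- apply/allP => x; rewrite mem_filter => /andP [x0 _]; apply/unity_rootP.
  by apply: (mulfI x0); rewrite -exprS prednK ?expf_card ?mulr1 //; apply/card_gt0P; exists 0.
- by rewrite filter_uniq ?enum_uniq.
- by rewrite crs.
have g0 : g != 0.
  apply/eqP => g0; have := prim_expr_order gP.
  by rewrite g0 expr0n; case: #|F|.-1 F0 => //= n _ /esym /eqP; rewrite oner_eq0.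
(* The order of F is odd: otherwise x^q = x at x = -1 would read 1 = -1. *)
have oF : (#|F|.-1)./2.*2 = #|F|.-1.
  rewrite even_halfK //; apply/negP => oF; have := expf_card (-1 : F).
  rewrite -(prednK (n := #|F|)); last by apply/card_gt0P; exists 0.
  by rewrite exprS -signr_odd oF expr1 mulrNN mulr1 => /eqP; rewrite (negbTE (eqr_opp_char2 _ (oner_neq0 F))).
set h := (#|F|.-1)./2 in oF *.
have gh : g ^+ h != 1.
  apply/eqP => /eqP; rewrite -(prim_order_dvd gP) => /dvdn_leq; lia.
have -> : -1 = g ^+ h.
  have : g ^+ h ^+ 2 == 1 by rewrite -exprM muln2 oF prim_expr_order.
  by rewrite sqrf_eq1 (negbTE gh) => /eqP.
rewrite etaX eta_nsq //; apply/eqP => /sqr_of_eta [x x0 xg].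
case/eqP: gh; apply: (mulfI x0).
by rewrite -xg -exprM mul2n oF -exprS prednK ?expf_card ?mulr1 //; apply/card_gt0P; exists 0.
Qed.

(** * Counting the solutions of diagonal quadratic equations *)

Local Notation q := (#|F|%:R : rat).

Lemma cardF_neq0 : q != 0.
Proof. by rewrite pnatr_eq0 -lt0n; apply/card_gt0P; exists 0. Qed.

Definition diag_count {n} (lam : 'I_n -> F) t : nat :=
  #|[set x : {ffun 'I_n -> F} | \sum_i lam i * x i ^+ 2 == t]|.

Lemma diag_count0 (lam : 'I_0 -> F) t : diag_count lam t = (t == 0).
Proof.
rewrite /diag_count (_ : [set _ | _] = if t == 0 then setT else set0).
  by case: eqP => _; rewrite ?cards0 ?cardsT ?card_ffun ?card_ord.
by apply/setP => x; rewrite inE big_ord0 eq_sym; case: eqP; rewrite !inE.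
Qed.

Lemma diag_countS n (lam : 'I_n.+1 -> F) t :
  diag_count lam t =
  (\sum_(x : F) diag_count (fun i => lam (lift ord0 i)) (t - lam ord0 * x ^+ 2)%R)%N.
Proof.
under eq_bigr do rewrite /diag_count -sum1_card.
rewrite pair_big_dep /= /diag_count -sum1_card.
pose join (z : F * {ffun 'I_n -> F}) :=
  [ffun i => if unlift ord0 i is Some j then z.2 j else z.1].
pose split (x : {ffun 'I_n.+1 -> F}) := (x ord0, [ffun j => x (lift ord0 j)]).
rewrite (reindex_onto join split) /=.
  apply: eq_bigl => -[x y]; rewrite !inE.
  have -> : split (join (x, y)) = (x, y).
    rewrite /split /join ffunE unlift_none; congr pair.
    by apply/ffunP => j; rewrite !ffunE liftK.
  rewrite eqxx andbT big_ord_recl ffunE unlift_none /=.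
  under eq_bigr do rewrite ffunE liftK.
  by rewrite [RHS]eq_sym subr_eq addrC eq_sym.
move=> x _; apply/ffunP => i; rewrite ffunE /=.
by case: unliftP => [j ->|->] //; rewrite ffunE.
Qed.

(* The relative deviation of the number of solutions from its mean, for a
   diagonal form of rank [2 * h + b] whose nonzero coefficients have product D. *)
Definition dev (h : nat) (b : bool) (D t : F) : rat :=
  q ^- h * (eta ((-1) ^+ h * D))%:~R *
  (if b then (eta t)%:~R else (if t == 0 then q else 0) - 1).

(** This is the effect of adding one square to the form. From odd rank, the sum is
    [sum_eta_affine_sq] with leading coefficient -l, which supplies the new factor -1 under [eta].
    From even rank, only the roots of x^2 = t / l have to be counted. *)
Lemma sum_dev h (b : bool) (D l t : F) : l != 0 ->
  \sum_(x : F) dev h b D (t - l * x ^+ 2) = q * dev (b + h) (~~ b) (l * D) t.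
Proof.
move=> l0; have q0 := cardF_neq0; rewrite -mulr_sumr /dev; case: b => /=.
  have -> : \sum_(x : F) (eta (t - l * x ^+ 2))%:~R = (eta (- l) * ((if t == 0 then #|F|%:R else 0) - 1))%:~R :> rat.
    rewrite -sum_eta_affine_sq ?oppr_eq0 // rmorph_sum.
    by apply: eq_bigr => x _; rewrite addrC mulNr.
  rewrite add1n !exprS !etaM -[- l]mulN1r etaM !intrM rmorphB /= !mulrA.
  have -> : (if t == 0 then #|F|%:R else 0)%:~R = (if t == 0 then q else 0).
    by case: ifP => _; rewrite ?rmorph_nat ?rmorph0.
  rewrite [q / _](_ : _ = q ^- h); last by rewrite invfM mulVKf.
  rewrite [1%:~R]mulr1z; move: (q ^- h) (if _ then q else 0) => A B; ring.
have -> : \sum_(x : F) ((if t - l * x ^+ 2 == 0 then q else 0) - 1) = q * (eta (l * t))%:~R.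
  rewrite sumrB sumr_const -big_mkcond /= sumr_const.
  have -> : #|[pred x | t - l * x ^+ 2 == 0]| = #|[set x : F | x ^+ 2 == t / l]|.
    apply: eq_card => x; rewrite !inE subr_eq0.
    by rewrite -(can2_eq (mulfK l0) (divfK l0)) mulrC eq_sym.
  (* l t and t / l differ by the square l^2, so they have the same character. *)
  rewrite -[l * t](_ : l ^+ 2 * (t / l) = _); last by rewrite expr2; field.
  have /(congr1 (fun z : int => z%:~R : rat)) := card_sqrt (t / l).
  rewrite rmorph_nat intrD mulr1z => E; rewrite -[X in X - _]mulr_natr E etaMsq //.
  by rewrite mulrDr mulr1 addrC addKr.
by rewrite add0n !etaM !intrM; ring.
Qed.

(** Induction on the number of variables: a zero coefficient multiplies the count by q and keeps the
    deviation, a nonzero one is handled by [sum_dev]. The factor q on the left replaces an exponent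
    n - 1, so that n = 0 can start the induction. *)
Lemma diag_countE n (lam : 'I_n -> F) t :
  let r := #|[pred i | lam i != 0]| in
  q * (diag_count lam t)%:R =
  q ^+ n * (1 + dev r./2 (odd r) (\prod_(i | lam i != 0) lam i) t).
Proof.
elim: n lam t => [|n IH] lam t /=.
  have -> : #|[pred i | lam i != 0]| = 0%N by apply: eq_card0 => -[].
  rewrite diag_count0 big_ord0 /dev /= !expr0 mulr1 invr1 eta1.
  by case: (t == 0) => /=; ring.
rewrite diag_countS natr_sum mulr_sumr.
rewrite (eq_bigr _ (fun x _ => IH (fun i => lam (lift ord0 i)) _)) /=.
have cE k (mu : 'I_k -> F) : #|[pred i | mu i != 0]| = (\sum_(i < k) (mu i != 0%R))%N.
  by rewrite -sum1_card big_mkcond; apply: eq_bigr => i _; rewrite inE; case: eqP.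
have -> : #|[pred i | lam i != 0]| =
    ((lam ord0 != 0%R) + #|[pred i | lam (lift ord0 i) != 0%R]|)%N.
  by rewrite !cE big_ord_recl.
rewrite [in RHS]big_mkcond [in RHS]big_ord_recl -[in RHS]big_mkcond /=.
set D := \prod_(i < n | _) _.
rewrite -mulr_sumr big_split /= sumr_const exprS -mulrA mulrCA; congr (_ * _).
case: (eqVneq (lam ord0) 0) => [->|l0] /=.
  under eq_bigr do rewrite mul0r subr0.
  by rewrite sumr_const mul1r mulrDr mulr1 mulr_natl.
by rewrite sum_dev // mulrDr mulr1 add0n uphalf_half.
Qed.
End Eta.

(** * Common zeros of subcodes and generalized Hamming weights *)

Section Codes.
Variables (F : finFieldType) (T : finType).
Local Notation W := {ffun T -> F^o}.

Definition affine_word {n} (u : T -> 'rV[F]_n) (w : W) : Prop :=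
  exists (g : 'cV[F]_n) (c : F), forall z, w z = (u z *m g) 0 0 + c.

(** The linear parts of a basis of K are the columns of a matrix G. For z in Z the points [u z] lie
    in one coset of the left kernel of G, and each is taken at most B times. Once Z has a point, G
    has rank [\dim K], so [\dim K] cannot exceed n. *)
Lemma card_zeros_le n (u : T -> 'rV[F]_n) (B : nat) (K : {vspace W}) (Z : {set T}) :
  (forall v, #|[set z | u z == v]| <= B)%N ->
  (forall w, w \in K -> affine_word u w) ->
  (forall w z, w \in K -> z \in Z -> w z = 0) ->
  (#|Z| <= if \dim K <= n then #|F| ^ (n - \dim K) * B else 0)%N.
Proof.
move=> uB KC KZ.
have [->|[z0 z0Z]] := set_0Vmem Z; first by rewrite cards0.
have bK (i : 'I_(\dim K)) : (vbasis K)`_i \in K.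
  by apply/vbasis_mem/mem_nth; rewrite size_tuple.
have [g gP] := fin_all_exists (fun i => KC _ (bK i)).
have [c cP] := fin_all_exists gP.
pose G := \matrix_(i < n, j < \dim K) g j i 0.
have GE z j : (u z *m G) 0 j = (vbasis K)`_j z - c j.
  by rewrite cP addrK !mxE; apply: eq_bigr => i _; rewrite mxE.
have ZG z : z \in Z -> u z *m G = u z0 *m G.
  by move=> zZ; apply/rowP => j; rewrite !GE !(KZ _ _ (bK j)).
(* A relation among the columns of G gives a constant word of K. It vanishes at the common zero z0,
   so it is the zero word, and freeness of the basis makes the relation trivial. *)
have rG : \rank G = \dim K.
  rewrite -mxrank_tr; apply/eqP/inj_row_free => v vG.
  have cst z : \sum_j v 0 j * (vbasis K)`_j z = \sum_j v 0 j * c j.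
    have : (u z *m G *m v^T) 0 0 = 0.
      by rewrite -mulmxA -[G]trmxK -trmx_mul vG trmx0 mulmx0 mxE.
    rewrite mxE => E; apply/eqP; rewrite -subr_eq0 -sumrB -[X in _ == X]E; apply/eqP/eq_bigr => j _.
    by rewrite GE [v^T _ _]mxE mulrBl; congr (_ - _); apply: mulrC.
  have /freeP fK := basis_free (vbasisP K).
  apply/rowP => j; rewrite mxE; apply: (fK (fun j => v 0 j)).
  apply/ffunP => z; rewrite sum_ffunE ffunE.
  under eq_bigr do rewrite ffunE.
  rewrite -[RHS](_ : \sum_j v 0 j * (vbasis K)`_j z0 = 0); first exact: etrans (cst z) (esym (cst z0)).
  by rewrite big1 // => i _; rewrite (KZ _ _ (bK i)) // mulr0.
have rn : (\dim K <= n)%N by rewrite -rG rank_leq_row.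
rewrite rn -rG -mxrank_ker -card_rowg.
rewrite -sum1_card (partition_big (fun z => u z - u z0) (mem (rowg (kermx G)))) /=; last first.
  by move=> z zZ; rewrite mem_rowg; apply/sub_kermxP; rewrite mulmxBl ZG ?subrr.
rewrite -sum_nat_const; apply: leq_sum => v _; rewrite sum1_card.
apply: leq_trans (uB (v + u z0)); apply/subset_leq_card/subsetP => z.
by rewrite !inE => /andP [_ /eqP <-]; rewrite subrK.
Qed.

(** The support of a subcode is the complement of its set of common zeros, so the most common zeros
    means the smallest support. *)
Lemma gen_weight_of_zeros (C : W -> Prop) (r b : nat) (K : {vspace W}) (Z : {set T}) :
  \dim K = r -> (forall w, w \in K -> C w) ->
  (forall z, z \in Z <-> forall w, w \in K -> w z = 0) -> #|Z| = b ->
  (forall (K' : {vspace W}) (Z' : {set T}), \dim K' = r -> (forall w, w \in K' -> C w) ->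
     (forall w z, w \in K' -> z \in Z' -> w z = 0) -> (#|Z'| <= b)%N) ->
  gen_weight C r (#|T| - b).
Proof.
move=> dK KC ZP Zb bnd; split.
  exists K; split=> //; exists (~: Z); split; last by rewrite cardsCs setCK Zb.
  move=> z; rewrite inE; split=> [zZ|[w wK wz]]; last first.
    by apply/negP => /ZP /(_ w wK) /eqP; rewrite (negbTE wz).
  have [/existsP [i wi]|/existsPn /= all0] :=
      boolP [exists i : 'I_(\dim K), (vbasis K)`_i z != 0].
    by exists (vbasis K)`_i => //; apply/vbasis_mem/mem_nth; rewrite size_tuple.
  case/negP: zZ; apply/ZP => w /coord_vbasis ->.
  rewrite sum_ffunE big1 // => i _; rewrite ffunE.
  by move: (all0 i); rewrite negbK => /eqP ->; rewrite scaler0.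
move=> K' s dK' K'C [A [AP <-]].
rewrite leq_subLR -(cardsC A) addnC leq_add2r.
apply: (bnd K') => // w z wK; rewrite inE => zA; apply/eqP.
by apply: contraNT zA => wz; apply/AP; exists w.
Qed.
End Codes.
Arguments affine_word {F T n}.

(** * Weights of the code of affine functions of (Q x, tau y) *)

Section ProductCode.
Variables (F : finFieldType) (X Y : finType) (k : nat) (Q : X -> F) (tau : Y -> 'rV[F]_k).
Hypothesis tau_bij : bijective tau.
Local Notation T := (X * Y)%type.
Local Notation W := {ffun T -> F^o}.

Definition eval_point (z : T) : 'rV[F]_(1 + k) := row_mx (Q z.1)%:M (tau z.2).

(** The tail of v determines y because tau is injective; only the x with Q x equal to the head of v
    remain. *)
Lemma card_eval_fibre (B : nat) (v : 'rV[F]_(1 + k)) :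
  (forall s, #|[set x | (Q x == s)%R]| <= B)%N -> (#|[set z | eval_point z == v]| <= B)%N.
Proof.
move=> NB; apply: leq_trans (NB (lsubmx v 0 0)).
rewrite -(card_in_imset (f := fst) (D := [set z | eval_point z == v])).
  apply/subset_leq_card/subsetP => x /imsetP [z]; rewrite !inE => /eqP <- ->.
  by rewrite /eval_point row_mxKl mxE.
move=> [x y] [x' y']; rewrite !inE => /eqP <- /eqP /esym E /= xx'; rewrite xx' in E *.
by congr pair; apply: (bij_inj tau_bij); case/eq_row_mx: E.
Qed.

Lemma affine_word_lin (w : W) a w' :
  affine_word eval_point w -> affine_word eval_point w' -> affine_word eval_point (a *: w + w').
Proof.
move=> [g [c wE]] [g' [c' wE']]; exists (a *: g + g'), (a * c + c') => z.
by rewrite !ffunE wE wE' mulmxDr -scalemxAr !mxE /GRing.scale /= mulrDr addrACA.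
Qed.

Lemma span_affine r (S : r.-tuple W) :
  (forall i, affine_word eval_point (tnth S i)) ->
  forall w, w \in <<S>>%VS -> affine_word eval_point w.
Proof.
move=> Sa w /coord_span ->; apply: (big_ind (affine_word eval_point)).
- by exists 0, 0 => z; rewrite mulmx0 !mxE addr0 ffunE.
- by move=> w1 w2 h1 h2; rewrite -[w1]scale1r; apply: affine_word_lin.
move=> i _; rewrite -[_ *: _]addr0; apply: affine_word_lin; first by rewrite -tnth_nth.
by exists 0, 0 => z; rewrite mulmx0 !mxE addr0 ffunE.
Qed.

Variable t : F.

(* Index 0 gives Q - t, indices 1, ..., k the coordinates of tau, and k + 1 the
   constant 1. *)
Definition extremal_coord (z : T) (i : nat) : F :=
  if i is j.+1 then (if insub j is Some j' then tau z.2 0 j' else 1) else Q z.1 - t.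

Definition extremal_word (i : nat) : W := [ffun z => extremal_coord z i].

Lemma extremal_word_affine i : affine_word eval_point (extremal_word i).
Proof.
rewrite /extremal_word; case: i => [|i].
  exists (col_mx 1 0), (- t) => z.
  by rewrite ffunE mul_row_col mulmx1 mulmx0 addr0 mxE.
case: (ltnP i k) => [ik|ki].
  exists (col_mx 0 (delta_mx (Ordinal ik) 0)), 0 => z.
  rewrite ffunE /extremal_coord insubT mul_row_col mulmx0 add0r addr0 -colE.
  by rewrite mxE; congr (tau _ _ _); apply: val_inj.
exists 0, 1 => z.
by rewrite ffunE /extremal_coord insubF ?mulmx0 ?mxE ?add0r // ltnNge ki.
Qed.

(** Evaluation isolates the coefficients one after another: Q x = t and tau y = 0 leave the constant
    word; then Q x different from t and tau y = 0 leave Q - t; finally Q x = t and tau y a unit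
    vector leave a single coordinate of tau. *)
Lemma extremal_free r : (exists x, Q x = t) -> (exists x, Q x != t) -> (r <= k.+2)%N ->
  free [tuple extremal_word i | i < r].
Proof.
move=> [x0 Qx0] [x1 Qx1] rk; apply/freeP => c cE.
have E z : \sum_(i < r) c i * extremal_coord z i = 0.
  move/ffunP/(_ z): cE; rewrite sum_ffunE ffunE => {2}<-; apply: eq_bigr => i _.
  by rewrite -tnth_nth tnth_mktuple !ffunE.
have [tau' tauK tauK'] := tau_bij.
have cN (i : 'I_r) : i = k.+1 :> nat -> c i = 0.
  move=> ik; have := E (x0, tau' 0); rewrite (bigD1 i) //= big1 => [|j].
    by rewrite ik /= insubF ?ltnn // mulr1 addr0.
  rewrite -val_eqE /= ik; case: j => -[|j] jr /=; first by rewrite Qx0 subrr mulr0.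
  case: insubP => [j' _ _|]; first by rewrite tauK' mxE mulr0.
  by move=> jk ne; exfalso; lia.
have c0 (i : 'I_r) : i = 0%N :> nat -> c i = 0.
  move=> i0; have := E (x1, tau' 0); rewrite (bigD1 i) //= big1 => [|j].
    rewrite i0 /= addr0 => /eqP; rewrite mulf_eq0 subr_eq0 (negbTE Qx1) orbF.
    by move/eqP.
  rewrite -val_eqE /= i0; case: j => -[|j] jr //= _.
  case: insubP => [j' _ _|]; first by rewrite tauK' mxE mulr0.
  by move=> jk; rewrite cN ?mul0r //=; lia.
move=> i; have [i0|i0] := eqVneq (i : nat) 0%N; first exact: c0.
have [ik|ik] := eqVneq (i : nat) k.+1; first exact: cN.
have ik' : (i.-1 < k)%N by have := ltn_ord i; lia.
have := E (x0, tau' (delta_mx 0 (Ordinal ik'))); rewrite (bigD1 i) //= big1 => [|j].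
  case: i i0 ik ik' => -[|i] ir //= _ _ ik.
  by rewrite insubT tauK' mxE !eqxx mulr1 addr0.
rewrite -val_eqE; case: j => -[|j] jr /= ji; first by rewrite Qx0 subrr mulr0.
case: insubP => [j' _ j'j|]; last by move=> jk; rewrite cN ?mul0r //=; lia.
rewrite tauK' mxE; have [jj|_] := eqVneq j' (Ordinal ik'); last by rewrite andbF mulr0.
by move: j'j ji; rewrite jj /=; lia.
Qed.

Lemma card_tau_vanish l : (l <= k)%N ->
  #|[set y | [forall i : 'I_k, (i < l)%N ==> (tau y 0 i == 0)]]| = (#|F| ^ (k - l))%N.
Proof.
move=> lk; have [tau' tauK tauK'] := tau_bij.
(* [v *m A] lists the first l entries of v, so the vectors to count form the kernel of A, which has
   rank l. *)
pose A : 'M[F]_(k, l) := pid_mx l.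
rewrite -[X in (k - X)%N](rank_pid_mx F lk (leqnn l)) -mxrank_ker -card_rowg.
rewrite -(card_imset _ (bij_inj tau_bij)); apply: eq_card => v.
have vA (j : 'I_l) : (v *m A) 0 j = v 0 (widen_ord lk j).
  rewrite mxE (bigD1 (widen_ord lk j)) //= /A mxE eqxx /= ltn_ord mulr1 big1 ?addr0 // => i.
  by rewrite -val_eqE mxE /= => /negbTE ->; rewrite mulr0.
rewrite mem_rowg; apply/imsetP/sub_kermxP => [[y]|v0].
  rewrite inE => /forallP yP vy; apply/rowP => j; rewrite vA vy mxE.
  by apply/eqP/(implyP (yP (widen_ord lk j)))/(ltn_ord j).
exists (tau' v); last by rewrite tauK'.
rewrite inE; apply/forallP => i; apply/implyP => il; rewrite tauK'.
move: (vA (Ordinal il)); rewrite v0 mxE => /esym /eqP.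
by congr (v 0 _ == 0); apply: val_inj.
Qed.

(** [card_zeros_le] bounds the zeros of every subcode. The span of the first r extremal words
    reaches the bound: for r at most k + 1 its zeros are the product of the fibre Q x = t with the y
    whose first r - 1 coordinates under tau vanish. *)
Lemma gen_weight_affine (C : W -> Prop) (r : nat) :
  (forall w, C w <-> affine_word eval_point w) ->
  (exists x, Q x = t) -> (exists x, Q x != t) ->
  (forall s, #|[set x | (Q x == s)%R]| <= #|[set x | (Q x == t)%R]|)%N ->
  (0 < r <= k.+2)%N ->
  gen_weight C r (#|X| * #|Y| - 
    (if r <= k.+1 then #|F| ^ (k.+1 - r) * #|[set x | (Q x == t)%R]| else 0))%N.
Proof.
move=> CP ht hnt Nt /andP [r0 rk]; rewrite -card_prod.
have fr := extremal_free r ht hnt rk.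
pose Z : {set T} := [set z | [forall i : 'I_r, extremal_word i z == 0]].
have Xa i : affine_word eval_point (tnth [tuple extremal_word i | i < r] i).
  by rewrite tnth_mktuple; apply: extremal_word_affine.
have ZP z : z \in Z <-> forall w, w \in <<[tuple extremal_word i | i < r]>>%VS -> w z = 0.
  rewrite inE; split=> [/forallP zZ w /coord_span ->|zK].
    rewrite sum_ffunE big1 // => i _.
    by rewrite ffunE -tnth_nth tnth_mktuple (eqP (zZ i)) scaler0.
  apply/forallP => i; apply/eqP/zK/memv_span.
  by apply/tnthP; exists i; rewrite tnth_mktuple.
have dK : \dim <<[tuple extremal_word i | i < r]>> = r.
  by move: fr; rewrite /free size_tuple => /eqP.
have bnd (K : {vspace W}) (Z' : {set T}) : \dim K = r -> (forall w, w \in K -> C w) ->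
    (forall w z, w \in K -> z \in Z' -> w z = 0) ->
    (#|Z'| <= if r <= k.+1 then #|F| ^ (k.+1 - r) * #|[set x | (Q x == t)%R]| else 0)%N.
  move=> dKr KC KZ; rewrite -[r in X in (_ <= X)%N]dKr.
  apply: (@card_zeros_le _ _ _ eval_point _ _ _ _ _ KZ) => [v|w /KC /CP //].
  exact: card_eval_fibre.
have KC w : w \in <<[tuple extremal_word i | i < r]>>%VS -> C w.
  by move=> wK; apply/CP; apply: span_affine wK.
apply: (@gen_weight_of_zeros F T C r _ <<[tuple extremal_word i | i < r]>>%VS Z) => //.
have lZ := bnd _ Z dK KC (fun w z wK zZ => (ZP z).1 zZ w wK).
(* For r = k + 2 the bound is 0 and already forces Z to be empty. *)
case: ifP lZ => [rk1 _|_]; last by rewrite leqn0 => /eqP.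
case: r r0 rk fr @Z Xa ZP dK bnd KC rk1 => // l _ _ _ Z _ _ _ _ _ lk.
rewrite subSS mulnC -(card_tau_vanish l) // -cardsX; apply: eq_card => -[x y].
rewrite !inE /=; apply/forallP/andP => [h|[/eqP Qx /forallP h] [[|i] il]].
- split; first by move: (h ord0); rewrite ffunE subr_eq0.
  apply/forallP => i; apply/implyP => il.
  by move: (h (Ordinal (il : i.+1 < l.+1)%N)); rewrite ffunE /= valK.
- by rewrite ffunE /= Qx subrr.
- have ik : (i < k)%N by lia.
  by rewrite ffunE /= insubT; apply: (implyP (h (Ordinal ik))).
Qed.
End ProductCode.

(** * The trace form and its nondegeneracy *)

Section Trace.
Variables (F : finFieldType) (L : fieldExtType F).
Local Notation s := (\dim {:L}).
Local Notation tr := (@trace F L #|F| s).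

Lemma card_finvect_type : #|finvect_type L| = (#|F| ^ s)%N.
Proof.
rewrite -(@card_vspacef F (finvect_type L) (Vector.class (finvect_type L : vectType F))).
by rewrite card_vspace.
Qed.

Lemma expr_cardF_D (i : nat) : {morph (fun x : L => x ^+ (#|F| ^ i)) : x y / x + y}.
Proof.
have [p pp pF] := finPcharP F.
have pL : p \in [pchar L] by rewrite pchar_lalg.
have FE : #|F| = (p ^ logn p #|F|)%N := card_pprimeChar pF.
move=> x y; apply: exprDn_pchar.
by rewrite (eq_pnat _ (pcharf_eq pL)) FE !pnatX pnat_id.
Qed.

Lemma expf_cardX (a : F) i : a ^+ (#|F| ^ i) = a.
Proof. by elim: i => [|i IH]; rewrite ?expr1 // expnSr exprM IH expf_card. Qed.

(** Since y^(q^s) = y, the q-th power permutes the summands cyclically. The sum is therefore fixed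
    by it and lies on the line of 1, where [coord] reads off the scalar. *)
Lemma trace_sumE (y : L) : \sum_(i < s) y ^+ (#|F| ^ i) = (tr y)%:A.
Proof.
have /vlineP [c cE] : \sum_(i < s) y ^+ (#|F| ^ i) \in 1%VS.
  rewrite (@Fermat's_little_theorem F L 1%AS) dimv1.
  have z1 : (0 : L) ^+ (#|F| ^ 1) = 0.
    by rewrite expn1 expr0n -[#|F|]prednK //; apply/card_gt0P; exists 0.
  rewrite (big_morph _ (expr_cardF_D 1) z1).
  under eq_bigr => i _ do rewrite -exprM -expnD addn1.
  have yE : y ^+ (#|F| ^ s) = y.
    by apply/eqP; rewrite -(@Fermat's_little_theorem F L {:L}%AS) memvf.
  apply/eqP/(addrI (y ^+ (#|F| ^ 0))).
  rewrite -[LHS](big_ord_recl s (fun i => y ^+ (#|F| ^ i))) big_ord_recr /= yE expr1 addrC.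
  by [].
rewrite cE /trace cE linearZ /= -[X in coord _ _ X]/([tuple (1 : L)]`_(@ord0 0)) coord_free.
  by rewrite eqxx mulr1.
by rewrite seq1_free oner_eq0.
Qed.

Lemma trace_lin (a : F) (x y : L) : tr (a *: x + y) = a * tr x + tr y.
Proof.
rewrite /trace -linearP /=; congr (coord _ _ _); rewrite scaler_sumr -big_split.
by apply: eq_bigr => i _; rewrite expr_cardF_D exprZn expf_cardX.
Qed.

Lemma trace0 : tr 0 = 0.
Proof.
have /eqP := trace_lin 1 0 0.
by rewrite scaler0 addr0 mul1r -subr_eq subrr eq_sym => /eqP.
Qed.

Lemma trace_sum n (c : 'I_n -> F) (v : 'I_n -> L) :
  tr (\sum_i c i *: v i) = \sum_i c i * tr (v i).
Proof.
elim: n c v => [|n IH] c v; first by rewrite !big_ord0 trace0.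
by rewrite !big_ord_recl trace_lin IH.
Qed.

Lemma trace_nondeg (b : L) : (forall y, tr (b * y) = 0) -> b = 0.
Proof.
move=> tb; apply/eqP; apply: contraT => b0.
have q1 : (1 < #|F|)%N by exact: finNzRing_gt1.
have s0 : (0 < s)%N by exact: adim_gt0.
(* The trace polynomial has degree q^(s-1), too small to vanish on all of L. *)
pose P : {poly L} := \sum_(i < s) 'X^(#|F| ^ i).
have PE y : P.[y] = 0.
  rewrite horner_sum; under eq_bigr do rewrite hornerXn.
  by rewrite trace_sumE -[y](mulVKf b0) tb scale0r.
have P0 : P != 0.
  apply/eqP => /(congr1 (fun R : {poly L} => R`_1)).
  rewrite coef0 coef_sum (bigD1 (Ordinal s0)) //= coefXn eqxx big1 ?addr0.
    by move/eqP; rewrite oner_eq0.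
  move=> i; rewrite -val_eqE /= -lt0n => i0; rewrite coefXn.
  by have := ltn_exp2l 0 i q1; rewrite i0 expn0 => /gtn_eqF; rewrite eq_sym => ->.
have sP : (size P <= (#|F| ^ s.-1).+1)%N.
  apply: leq_trans (size_sum _ _ _) _; apply/bigmax_leqP => i _.
  by rewrite size_polyXn ltnS leq_exp2l // -ltnS prednK.
pose rs : seq L := enum (finvect_type L).
have rs_size : size rs = (#|F| ^ s)%N by rewrite -card_finvect_type cardE.
have rs_uniq : uniq rs by exact: (enum_uniq (finvect_type L)).
have Prs : all (root P) rs by apply/allP => y _; rewrite /root PE.
have := leq_trans (max_poly_roots P0 Prs rs_uniq) sP.
rewrite rs_size ltnS leqNgt => /negP [].
by rewrite ltn_exp2l // prednK.
Qed.

(** The traces against a basis determine tr (b y) for all b, so nondegeneracy gives injectivity, and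
    both sides have q^s elements. *)
Lemma trace_pairing_bij :
  bijective (fun y : finvect_type L => \row_(i < s) tr ((vbasis {:L})`_i * (y : L))).
Proof.
apply: inj_card_bij; last by rewrite card_mx mul1n card_finvect_type.
move=> y y' /rowP E; apply/eqP; rewrite -subr_eq0; apply/eqP.
apply: (@trace_nondeg ((y : L) - (y' : L))) => b.
rewrite mulrC (coord_vbasis (memvf b)) mulr_suml.
under eq_bigr do rewrite -scalerAl.
rewrite trace_sum big1 // => i _; have := E i; rewrite !mxE => /eqP.
rewrite -subr_eq0 addrC -mulN1r -trace_lin => /eqP.
by rewrite scaleN1r addrC -mulrBr => ->; rewrite mulr0.
Qed.
End Trace.

(** * The code of Q: fibre sizes and generalized weights *)

Section QuadraticCode.
Variables (F : finFieldType) (L1 L2 : fieldExtType F) (Q : L1 -> F).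
Local Notation m1 := (\dim {:L1}).
Local Notation m2 := (\dim {:L2}).
Local Notation q := (#|F|%:R : rat).
Local Notation tau :=
  (fun y : finvect_type L2 => \row_(i < m2) @trace F L2 #|F| m2 ((vbasis {:L2})`_i * (y : L2))).
Local Notation point := (@eval_point F (finvect_type L1) (finvect_type L2) m2 Q tau).

(** The linear coefficients are a, for the coordinate Q x, and the coordinates of b in the chosen
    basis of L2, for those of tau y. *)
Lemma codeCQ_affine w : codeCQ #|F| m2 Q w <-> affine_word point w.
Proof.
split=> [[a [b [c ->]]]|[g [c wE]]].
  exists (col_mx a%:M (\col_i coord (vbasis {:L2}) i b)), c => z.
  rewrite ffunE mul_row_col -scalar_mxM !mxE mulr1n mulrC; congr (_ + _ + _).
  rewrite {1}(coord_vbasis (memvf b)) mulr_suml.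
  under eq_bigr do rewrite -scalerAl.
  by rewrite trace_sum; apply: eq_bigr => i _; rewrite !mxE mulrC.
exists (usubmx g 0 0), (\sum_i dsubmx g i 0 *: (vbasis {:L2})`_i), c.
apply/ffunP => z; rewrite wE ffunE -[g in LHS]vsubmxK mul_row_col mxE; congr (_ + _ + _).
  by rewrite mul_scalar_mx mxE mulrC.
rewrite mulr_suml; under eq_bigr do rewrite -scalerAl.
by rewrite trace_sum mxE; apply: eq_bigr => i _; rewrite !mxE mulrC.
Qed.

Variables (e : m1.-tuple L1) (lam : 'I_m1 -> F) (rQ : nat).
Hypothesis Hdiag : qf_diag Q rQ e lam.

Lemma card_fibre_diag t :
  #|[set x : finvect_type L1 | Q x == t]| = diag_count F lam t.
Proof.
have [eB [_ QE]] := Hdiag.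
pose f (x : {ffun 'I_m1 -> F}) : finvect_type L1 := \sum_(i < m1) x i *: tnth e i.
have fI : injective f.
  move=> x y fxy; apply/ffunP => i; have eF := basis_free eB.
  have fE z j : coord e j (f z) = z j.
    rewrite /f; under eq_bigr do rewrite (tnth_nth 0).
    by rewrite coord_sum_free.
  by rewrite -(fE x) fxy fE.
rewrite /diag_count -(card_imset _ fI); apply: eq_card => x.
rewrite inE; apply/idP/imsetP => [xt|[y]]; last first.
  by rewrite inE => /eqP <- ->; rewrite /f QE.
exists [ffun i => coord e i x]; last first.
  rewrite /f [LHS](coord_basis eB (memvf x)); apply: eq_bigr => i _.
  by rewrite ffunE (tnth_nth 0).
rewrite inE -QE -(eqP xt); apply/eqP; congr (Q _).
rewrite [RHS](coord_basis eB (memvf x)); apply: eq_bigr => i _.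
by rewrite ffunE (tnth_nth 0).
Qed.

Hypothesis F2 : (2%:R : F) != 0.
Hypothesis rQ_le : (rQ <= m1)%N.
Let D := \prod_(i < m1 | (i < rQ)%N) lam i.
Local Notation delta := (dev F rQ./2 (odd rQ) D).

Lemma card_fibreE t :
  q * #|[set x : finvect_type L1 | Q x == t]|%:R = q ^+ m1 * (1 + delta t).
Proof.
have [_ [lamP _]] := Hdiag.
rewrite card_fibre_diag diag_countE //.
have -> : #|[pred i | lam i != 0]| = rQ.
  rewrite -[RHS]card_ord -(card_imset _ (f := widen_ord rQ_le)) => [|i j /(congr1 val) ij]; last exact: val_inj.
  apply: eq_card => i; rewrite inE -lamP; apply/idP/imsetP => [iQ|[j _ ->]]; last exact: ltn_ord j.
  by exists (Ordinal iQ) => //; apply: val_inj.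
by rewrite (eq_bigl (fun i : 'I_m1 => (i < rQ)%N)).
Qed.

(** The largest deviation gives the largest fibre. Its being nonnegative makes the fibre over t
    nonempty, and Q takes a value other than t because it takes both 0 and a nonzero value. *)
Lemma codeCQ_gen_weight (t : F) (r : nat) :
  Q 0 = 0 -> (exists x, Q x != 0) ->
  0 <= delta t -> (forall s, delta s <= delta t) ->
  (0 < r <= m2.+2)%N ->
  exists d, gen_weight (@codeCQ F L1 L2 #|F| m2 Q) r d /\
    d%:R = if (r < m2.+2)%N then q ^+ (m1 + m2 - r) * (q ^+ r - 1 - delta t)
           else q ^+ (m1 + m2).
Proof.
move=> Q0 [x1 Qx1] dt0 dmax rm.
have q0 : 0 < q by rewrite lt0r cardF_neq0 ler0n.
pose N s := #|[set x : finvect_type L1 | Q x == s]|.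
have NE s : q * (N s)%:R = q ^+ m1 * (1 + delta s) := card_fibreE s.
have Nmax s : (N s <= N t)%N.
  by rewrite -(ler_nat rat) -(ler_pM2l q0) !NE ler_pM2l ?exprn_gt0 // lerD2l.
have Nt0 : (0 < N t)%N.
  by rewrite -(ltr_nat rat) -(ltr_pM2l q0) NE mulr0 mulr_gt0 ?exprn_gt0 // ltr_wpDr.
have tim : exists x : finvect_type L1, Q x = t.
  by case/card_gt0P: Nt0 => x; rewrite inE => /eqP; exists x.
have tnim : exists x : finvect_type L1, Q x != t.
  have [->|t0] := eqVneq t 0; first by exists x1.
  by exists 0; rewrite Q0 eq_sym.
have m1_gt0 : (0 < m1)%N by exact: adim_gt0.
eexists; split.
  exact: (gen_weight_affine _ _ _ _ _ _ (trace_pairing_bij F L2) _ _ _ codeCQ_affine tim tnim Nmax rm).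
rewrite !card_finvect_type ltnS -/(N t).
have [rk|rk] := leqP r m2.+1; last by rewrite subn0 natrM !natrX exprD.
have Nle : (N t <= #|F| ^ m1)%N by rewrite -card_finvect_type; apply: max_card.
(* The zeros do not outnumber the coordinates, so the natural subtraction is not truncated. *)
rewrite natrB; last first.
  rewrite mulnC leq_mul // leq_exp2l ?finNzRing_gt1 //; case/andP: rm => ? ?; lia.
apply: (mulfI (cardF_neq0 F)).
rewrite !natrM !natrX mulrBr mulrCA -/(N t) [q * (_ * (N t)%:R)]mulrCA NE.
have -> : q ^+ m1 * (q * q ^+ m2) = q * (q ^+ (m1 + m2 - r) * q ^+ r).
  rewrite -exprD subnK ?exprD; [by rewrite mulrCA|lia].
have -> : q ^+ (m2.+1 - r) * (q ^+ m1 * (1 + delta t)) = q * (q ^+ (m1 + m2 - r) * (1 + delta t)).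
  by rewrite !mulrA -exprD -exprS; congr (_ ^+ _ * _); lia.
by ring.
Qed.
End QuadraticCode.

(** * The sign epsilon and the three cases of the theorem *)

Lemma odd_half_pred_expn (k m : nat) : odd ((k.*2.+1 ^ m).-1)./2 = odd (k * m).
Proof.
(* This is the congruence (1 + 2k)^m = 1 + 2km modulo 4. *)
have [j [jE jo]] : exists j, (k.*2.+1 ^ m = j.*2.+1)%N /\ odd j = odd (k * m).
  elim: m => [|m [j [jE jo]]]; first by exists 0%N; rewrite muln0.
  exists (k.*2 * j + k + j)%N; split; first by rewrite expnS jE; lia.
  by rewrite mulnS !oddD oddM odd_double jo addbC.
by rewrite jE /= doubleK.
Qed.

(** Identifies the sign in [dev] with epsilon for rank 2h: [etaN1] has exponent (q-1)/2, which has
    the parity of m (p-1)/2, and the division by 4 is exact because p is odd. *)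
Lemma eta_sign (F : finFieldType) (p m h : nat) (D : F) :
  (2%:R : F) != 0 -> odd p -> #|F| = (p ^ m)%N ->
  eta ((-1) ^+ h * D) = eta D * (-1) ^+ ((p - 1) * m * h.*2 %/ 4).
Proof.
move=> F2 op FE; rewrite etaM // etaX // etaN1 // mulrC -exprM FE.
have [k ->] : exists k, p = k.*2.+1 by exists p./2; rewrite -[LHS]odd_double_half op.
have -> : ((k.*2.+1 - 1) * m * h.*2 = k * m * h * 4)%N by rewrite subn1 /=; lia.
rewrite mulnK //; congr (_ * _); rewrite -[LHS]signr_odd -[RHS]signr_odd.
by rewrite oddM odd_half_pred_expn -oddM.
Qed.

Lemma intr_eta_le1 (F : finFieldType) (a : F) : (eta a)%:~R <= 1 :> rat.
Proof. by rewrite /Defs.eta; case: ifP => _ //; case: ifP. Qed.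

Theorem theorem4 (p m m1 m2 : nat) (F : finFieldType) (L1 L2 : fieldExtType F)
  (Hp : prime p) (Hodd : odd p) (Hm : (0 < m)%N) (HpF : p \in [pchar F])
  (HF : #|F| = (p ^ m)%N) (Hm1 : (0 < m1)%N) (Hm2 : (0 < m2)%N)
  (HL1 : \dim {:L1} = m1) (HL2 : \dim {:L2} = m2)
  (Q : L1 -> F) (HQ : is_qform Q) (HQ0 : exists x, Q x != 0)
  (rQ : nat) (HrQ : qf_rank Q rQ)
  (e : m1.-tuple L1) (lam : 'I_m1 -> F) (Hdiag : qf_diag Q rQ e lam) :
  let q := (p ^ m)%N in
  let M := (m1 + m2)%N in
  let epsQ := qf_eps rQ lam in
  let eps : int := if ~~ odd rQ then epsQ * (-1) ^+ ((p - 1) * m * rQ %/ 4)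
                   else epsQ * (-1) ^+ ((p - 1) * m * rQ.+1 %/ 4) in
  let C := @codeCQ F L1 L2 q m2 Q in
  let qQ : rat := q%:R in
  forall r : nat, (1 <= r <= m2 + 2)%N ->
  [/\ (~~ odd rQ -> eps = 1 ->
        exists d, gen_weight C r d /\
          d%:R = (if (r < m2 + 2)%N
                  then qQ ^+ (M - r) * (qQ ^+ r - 1 - (qQ - 1) * qQ ^- (rQ %/ 2))
                  else qQ ^+ M)),
      (~~ odd rQ -> eps = -1 ->
        exists d, gen_weight C r d /\
          d%:R = (if (r < m2 + 2)%N
                  then qQ ^+ (M - r) * (qQ ^+ r - 1 - qQ ^- (rQ %/ 2))
                  else qQ ^+ M))
    & (odd rQ ->
        exists d, gen_weight C r d /\
          d%:R = (if (r < m2 + 2)%N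
                  then qQ ^+ (M - r) * (qQ ^+ r - 1 - qQ ^- ((rQ - 1) %/ 2))
                  else qQ ^+ M))].
Proof.
move=> q M epsQ eps C qQ r rm.
have F2 : (2%:R : F) != 0.
  apply/negP => /eqP F2; have := pcharf_eq HpF 2%N.
  rewrite !inE F2 eqxx /= => /esym /eqP p2; by rewrite -p2 in Hodd.
have Q0 : Q 0 = 0 by case: HQ => QZ _; rewrite -(scale0r (0 : L1)) QZ expr0n mul0r.
have rQle : (rQ <= \dim {:L1})%N by case: HrQ => U [_ ->]; apply: leq_subr.
subst m1 m2.
have qE : qQ = #|F|%:R by rewrite HF.
have q1 : 1 <= qQ by rewrite qE ler1n ltnW ?finNzRing_gt1.
have qh0 h : 0 <= qQ ^- h by rewrite invr_ge0 exprn_ge0 // (le_trans ler01).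
rewrite addn2 in rm *.
(* It remains, in each case, to find the largest deviation [dlt] and a t where it is attained. *)
have key t dlt : dev F rQ./2 (odd rQ) (\prod_(i < \dim {:L1} | (i < rQ)%N) lam i) t = dlt ->
    0 <= dlt ->
    (forall s, dev F rQ./2 (odd rQ) (\prod_(i < \dim {:L1} | (i < rQ)%N) lam i) s <= dlt) ->
    exists d, gen_weight C r d /\
      d%:R = if (r < (\dim {:L2}).+2)%N then qQ ^+ (M - r) * (qQ ^+ r - 1 - dlt) else qQ ^+ M.
  rewrite qE /C /q -HF => <- d0 dm.
  exact: (codeCQ_gen_weight _ _ _ _ _ _ _ Hdiag F2 rQle t r Q0 HQ0 d0 dm rm).
have even_eps : ~~ odd rQ -> eta ((-1) ^+ rQ./2 * \prod_(i < \dim {:L1} | (i < rQ)%N) lam i) = eps.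
  move=> er; rewrite (eta_sign _ _ _ _ _ F2 Hodd HF) even_halfK // /eps er //.
rewrite !divn2; split=> [er e1|er e1|or].
(* With sign 1 the factor is q - 1 at 0 and -1 elsewhere, so t = 0 is best. *)
- apply: (key 0) => [||s]; rewrite /dev ?(negbTE er) ?even_eps // ?e1 ?mulr1z ?mulrN1z -?qE.
  + by rewrite eqxx mulr1 mulrC.
  + by rewrite mulr_ge0 ?subr_ge0.
  + rewrite mulr1 mulrC ler_wpM2r //.
    by case: eqP => _ //; lra.
(* With sign -1 these factors change sign, so any nonzero t is best, for instance 1. *)
- apply: (key 1) => [||s]; rewrite /dev ?(negbTE er) ?even_eps // ?e1 ?mulr1z ?mulrN1z -?qE.
  + by rewrite oner_eq0 add0r mulrN1 mulrN mulr1 opprK.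
  + rewrite mulrN1 mulNr -mulrN -[leRHS]mulr1 ler_wpM2l //.
    by case: eqP => _; lra.
(* For odd rank the deviation at t is [eta E * eta t] up to a positive factor; t = E makes this
   product 1, since E is nonzero. *)
set E := (-1) ^+ rQ./2 * \prod_(i < \dim {:L1} | (i < rQ)%N) lam i in even_eps.
have E0 : E != 0.
  rewrite mulf_neq0 ?signr_eq0 //; apply/prodf_neq0 => i iQ.
  by case: Hdiag => _ [<- _].
rewrite subn1 (_ : rQ.-1./2 = rQ./2); last by lia.
apply: (key E) => [||s]; rewrite /dev ?or -/E -?qE //.
- by rewrite -mulrA -intrM -etaM // -expr2 eta_sqr ?mulr1.
- by rewrite -mulrA -intrM -etaM // -[leRHS]mulr1 ler_wpM2l // intr_eta_le1.
Qed.
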